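(* For every integer $n\geq 1$ we have $\mathscr T_{n+2}\sqsubseteq_{\rm FO}\mathscr{PW}_{n+1}$ but $\mathscr T_{n+2}\not\sqsubseteq_{\rm FO}\mathscr{PW}_n$. Consequently, $\mathscr{PW}_{n+1}\not\sqsubseteq_{\rm FO}\mathscr{PW}_n$.
   Context: Graphs are finite, undirected and loopless; a class of graphs is a set of graphs considered up to isomorphism, and every class contains the empty graph. $\mathscr T_n$ is the class of forests of depth (at most) $n$, i.e. forests whose components can be rooted so that every root-to-leaf path has at most $n$ vertices (so $\mathscr T_1$ is the class of edgeless graphs and $\mathscr T_2$ the class of star forests). $\mathscr{PW}_n$ is the class of all graphs of pathwidth at most $n$, where the pathwidth of $G$ is $\min\{\omega(H)-1: H\text{ an interval graph with }H\supseteq G\}$ ($\omega$ is the clique number). For a set $\mathcal U$ of unary relation symbols, a $\mathcal U$-colored graph is a graph with additional unary relations in $\mathcal U$. Formulas are first-order, with adjacency relation $E$. Transductions. For a positive integer $k$, the $k$-copy operation $\mathsf C_k$ maps a graph $G$ to the graph consisting of $k$ copies of $G$ in which the $k$ copies of each vertex are made pairwise adjacent (no other edges between the copies). The coloring operation $\Gamma_{\mathcal U}$ maps a graph to the set of all its $\mathcal U$-expansions. A simple interpretation $\mathsf I=(\nu(x),\eta(x,y))$ of graphs in $\mathcal U$-colored graphs is a pair of first-order formulas with $\eta$ symmetric and anti-reflexive; $\mathsf I(G^+)$ is the graph with vertex set $\nu(G^+)$ and edge set $\eta(G^+)\cap\nu(G^+)^2$. A transduction is a composition $\mathsf T=\mathsf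 I\circ\Gamma_{\mathcal U}\circ\mathsf C_k$, so $\mathsf T(G)=\{\mathsf I(G^+): G^+\in\Gamma_{\mathcal U}(\mathsf C_k(G))\}$. For a class $\mathscr D$, $\mathsf T(\mathscr D)=\bigcup_{G\in\mathscr D}\mathsf T(G)$ up to isomorphism. $\mathscr C\sqsubseteq_{\rm FO}\mathscr D$ means $\mathscr C\subseteq\mathsf T(\mathscr D)$ for some transduction $\mathsf T$. *)

(* Defs.v *)
From Stdlib Require Import Reals.
From mathcomp Require Import all_boot all_order all_algebra.

Set Implicit Arguments.
Unset Strict Implicit.
Unset Printing Implicit Defensive.

Record sgraph := SGraph {
  vertex :> finType;
  edge : rel vertex;
  edge_sym : symmetric edge;
  edge_irrefl : irreflexive edge }.

Definition giso (G H : sgraph) : Prop :=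
  exists f : G -> H, bijective f /\ forall x y, edge (f x) (f y) = edge x y.

(* [G] is, up to isomorphism, a (not necessarily induced or spanning) subgraph
   of [H]. *)
Definition subgraph (G H : sgraph) : Prop :=
  exists f : G -> H, injective f /\ forall x y, edge x y -> edge (f x) (f y).

(* Every class considered below is invariant under [giso]. *)
Definition graph_class := sgraph -> Prop.

(* [ucycle] also accepts the closed walk [:: x; y] along an edge, which is not
   a cycle of the graph. *)
Definition forest (G : sgraph) : Prop :=
  forall c : seq G, ucycle (@edge G) c -> size c <= 2.

Definition rooting (G : sgraph) (R : {set G}) : Prop :=
  forall x : G, exists! r : G, r \in R /\ connect (@edge G) x r.

(* [r :: p] is a path from [r] to a leaf of the tree rooted at [r].  In a
   forest, a neighbour of the end of the path that is not its child is its
   parent, hence lies on the path. *)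
Definition path_to_leaf (G : sgraph) (r : G) (p : seq G) : Prop :=
  [/\ path (@edge G) r p, uniq (r :: p)
    & forall y, edge (last r p) y -> y \in r :: p].

Definition forest_depth (n : nat) : graph_class := fun G =>
  forest G /\
  exists2 R : {set G}, rooting R &
    forall (r : G) (p : seq G), r \in R -> path_to_leaf r p ->
      size (r :: p) <= n.

Definition clique (G : sgraph) (A : {set G}) : bool :=
  [forall x in A, forall y in A, (x != y) ==> edge x y].

Definition clique_number (G : sgraph) : nat :=
  \max_(A : {set G} | clique A) #|A|.

Definition interval_graph (G : sgraph) : Prop :=
  exists lo hi : G -> R,
    (forall x, Rle (lo x) (hi x)) /\
    forall x y, x != y ->
      (edge x y <-> exists t : R,
         [/\ Rle (lo x) t, Rle t (hi x), Rle (lo y) t & Rle t (hi y)]).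

(* The width is an integer because that of the empty graph is -1. *)
Definition is_pathwidth (G : sgraph) (w : int) : Prop :=
  (exists H : sgraph, [/\ interval_graph H, subgraph G H
                        & w = ((clique_number H)%:Z - 1)%R]) /\
  (forall H : sgraph, interval_graph H -> subgraph G H ->
                      (w <= (clique_number H)%:Z - 1)%R).

Definition pathwidth_le (n : nat) : graph_class := fun G =>
  exists2 w : int, is_pathwidth G w & (w <= n%:Z)%R.

(* [formula U n]: formulas whose free variables are among n de Bruijn indices;
   a quantifier binds index 0 and shifts the other ones. *)
Inductive formula (U : Type) : nat -> Type :=
| FFalse n : formula U n
| FEq n : 'I_n -> 'I_n -> formula U n
| FEdge n : 'I_n -> 'I_n -> formula U n
| FColor n : U -> 'I_n -> formula U n
| FNot n : formula U n -> formula U n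
| FAnd n : formula U n -> formula U n -> formula U n
| FOr n : formula U n -> formula U n -> formula U n
| FExists n : formula U n.+1 -> formula U n
| FForall n : formula U n.+1 -> formula U n.

Definition expansion (U : Type) (G : sgraph) := U -> pred G.

Fixpoint sat (U : Type) (G : sgraph) (c : expansion U G) (n : nat)
    (phi : formula U n) : n.-tuple G -> bool :=
  match phi in formula _ n return n.-tuple G -> bool with
  | FFalse _ => fun _ => false
  | FEq _ i j => fun e => tnth e i == tnth e j
  | FEdge _ i j => fun e => edge (tnth e i) (tnth e j)
  | FColor _ u i => fun e => c u (tnth e i)
  | FNot _ f => fun e => ~~ sat c f e
  | FAnd _ f g => fun e => sat c f e && sat c g e
  | FOr _ f g => fun e => sat c f e || sat c g e
  | FExists _ f => fun e => [exists x : G, sat c f [tuple of x :: e]]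
  | FForall _ f => fun e => [forall x : G, sat c f [tuple of x :: e]]
  end.

Record interpretation (U : Type) := Interpretation {
  nu : formula U 1;
  eta : formula U 2;
  eta_sym : forall (G : sgraph) (c : expansion U G) (x y : G),
    sat c eta [tuple x; y] = sat c eta [tuple y; x];
  eta_irrefl : forall (G : sgraph) (c : expansion U G) (x : G),
    sat c eta [tuple x; x] = false }.

Section Interpret.
Variables (U : Type) (I : interpretation U) (G : sgraph) (c : expansion U G).

Definition interp_vertex : finType := {x : G | sat c (nu I) [tuple x]}.

Definition interp_edge : rel interp_vertex :=
  fun x y => sat c (eta I) [tuple val x; val y].

Lemma interp_edge_sym : symmetric interp_edge.
Proof. by move=> x y; apply: eta_sym. Qed.

Lemma interp_edge_irrefl : irreflexive interp_edge.
Proof. by move=> x; apply: eta_irrefl. Qed.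

Definition interpret : sgraph := SGraph interp_edge_sym interp_edge_irrefl.
End Interpret.

Section Copy.
Variables (k : nat) (G : sgraph).

Definition copy_edge : rel (G * 'I_k) := fun x y =>
  (x.2 == y.2) && edge x.1 y.1 || (x.1 == y.1) && (x.2 != y.2).

Lemma copy_edge_sym : symmetric copy_edge.
Proof.
by move=> x y; rewrite /copy_edge edge_sym (eq_sym x.1) (eq_sym x.2).
Qed.

Lemma copy_edge_irrefl : irreflexive copy_edge.
Proof. by move=> x; rewrite /copy_edge edge_irrefl !eqxx. Qed.

Definition copy : sgraph := SGraph copy_edge_sym copy_edge_irrefl.
End Copy.

Record transduction := Transduction {
  copies : nat;
  copies_gt0 : 0 < copies;
  colors : Type;
  interp : interpretation colors }.

Definition transduce (T : transduction) (D : graph_class) : graph_class :=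
  fun H => exists2 G : sgraph, D G &
    exists c : expansion (colors T) (copy (copies T) G),
      giso H (interpret (interp T) c).

Definition fo_le (C D : graph_class) : Prop :=
  exists T : transduction, forall G : sgraph, C G -> transduce T D G.

(* Main.v *)
(* A forest of depth at most [d] is contained in an interval graph of clique
   number at most [d]: number the root paths in base [#|G|].  Hence the first
   claim holds by the identity transduction, and the third follows from the
   second.

   For the second claim, induct on the bag size [w]: for every quantifier rank
   and numbers of colors and copies there is a forest of depth [w + 1] that no
   graph with bags of size at most [w] represents.  If [F] works for [w], take
   many disjoint copies of a root joined to many copies of [F].  In a
   representation over [H], pairs at large distance in [H] are adjacent or not
   according to a bounded number of labels (a weak form of Gaifman locality), so
   three copies with equally labelled long edges would contradict each other;
   hence in some copy all edges are short and the copy has bounded radius in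
   [H].  A set [P] of boundedly many vertices of [H] then covers the time span of
   this copy, and deleting [P] lowers the bag size by one.  Some copy of [F]
   avoids [P] and is still represented once the adjacencies to [P] and to the
   bags at both ends of the time span are recorded by colors. *)

From Stdlib Require Import Reals Lra Classical.
From Stdlib Require List.
Require Import Defs.
From mathcomp Require Import ssralg ssrint.
From mathcomp Require Import all_boot zify.

Set Implicit Arguments.
Unset Strict Implicit.
Unset Printing Implicit Defensive.

(** * Distances and Ehrenfeucht-Fraisse games *)

Section Distance.
Variable G : sgraph.
Implicit Types x y z : G.

Definition dist_le n x y : bool :=
  [exists p : n.-bseq G, path (@edge G) x p && (last x p == y)].

Lemma dist_leP n x y :
  reflect (exists p : seq G, [/\ path (@edge G) x p, last x p = y & size p <= n])
          (dist_le n x y).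
Proof.
apply: (iffP existsP) => [[p /andP[xp /eqP py]]|[p [xp py pn]]].
  by exists p; split=> //; exact: size_bseq.
by exists (Bseq pn); rewrite /= xp py eqxx.
Qed.

Lemma dist_le_refl n x : dist_le n x x.
Proof. by apply/dist_leP; exists [::]. Qed.

Lemma dist_le_edge x y : edge x y -> dist_le 1 x y.
Proof. by move=> xy; apply/dist_leP; exists [:: y]; rewrite /= xy. Qed.

Lemma dist_le_mono m n x y : m <= n -> dist_le m x y -> dist_le n x y.
Proof.
move=> mn /dist_leP[p [xp py pm]]; apply/dist_leP; exists p; split=> //.
exact: leq_trans mn.
Qed.

Lemma dist_le_trans m n x y z :
  dist_le m x y -> dist_le n y z -> dist_le (m + n) x z.
Proof.
move=> /dist_leP[p [xp py pm]] /dist_leP[q [yq qz qn]].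
apply/dist_leP; exists (p ++ q); split.
- by rewrite cat_path xp py.
- by rewrite last_cat py.
- by rewrite size_cat leq_add.
Qed.

Lemma dist_le_sym n x y : dist_le n x y = dist_le n y x.
Proof.
suff H u v : dist_le n u v -> dist_le n v u by apply/idP/idP; exact: H.
move=> /dist_leP[p [up uv pn]]; apply/dist_leP.
exists (rev (belast u p)); split.
- by rewrite -uv rev_path; under eq_path do rewrite edge_sym.
- by case: p {up pn} uv => [|a p] //= _; rewrite rev_cons last_rcons.
- by rewrite size_rev size_belast.
Qed.

End Distance.

Section Game.
Variables (G : sgraph) (C : finType) (lam : G -> C).
Implicit Type s : seq (G * G).

Definition partial_iso s : Prop :=
  (forall p, p \in s -> lam p.1 = lam p.2) /\
  forall p p', p \in s -> p' \in s ->
    (p.1 == p'.1) = (p.2 == p'.2) /\ edge p.1 p'.1 = edge p.2 p'.2.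

(** Duplicator wins the [q]-round Ehrenfeucht-Fraisse game whose two boards are the same labelled
    graph, from the position where the pairs in [s] have been chosen. *)
Fixpoint game_equiv q s : Prop :=
  if q is q'.+1 then
    (forall x, exists y, game_equiv q' ((x, y) :: s)) /\
    (forall y, exists x, game_equiv q' ((x, y) :: s))
  else partial_iso s.

Lemma partial_iso_sub s s' :
  {subset s' <= s} -> partial_iso s -> partial_iso s'.
Proof.
by move=> ss' [Hc He]; split=> [p /ss'/Hc|p p' /ss' sp /ss' sp'] //; apply: He.
Qed.

Lemma game_equiv_partial_iso q s : game_equiv q s -> partial_iso s.
Proof.
elim: q s => [|q IH] s //= [H _].
case: s H => [|p s] H; first by split.
have [y /IH] := H p.1.
by apply: partial_iso_sub => p' ps'; rewrite inE ps' orbT.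
Qed.

Lemma game_equiv_leq q q' s : q <= q' -> game_equiv q' s -> game_equiv q s.
Proof.
elim: q q' s => [|q IH] q' s; first by move=> _; apply: game_equiv_partial_iso.
case: q' => // q' /IH{}IH [H1 H2]; split.
  by move=> x; have [y /IH] := H1 x; exists y.
by move=> x; have [y /IH] := H2 x; exists y.
Qed.

Definition atomic_type k : finType :=
  ({ffun 'I_k * 'I_k -> bool * bool} * {ffun 'I_k -> C})%type.

(** Types of rank [q] are hereditarily finite sets drawn from a universe that depends only on [C],
    [q] and [k]. Hence their number is bounded uniformly in the graph. *)
Fixpoint rank_type q k : finType :=
  if q is q'.+1 then {set rank_type q' k.+1} else atomic_type k.

Definition atomic_tp k (e : k.-tuple G) : atomic_type k :=
  ([ffun ij => (tnth e ij.1 == tnth e ij.2, edge (tnth e ij.1) (tnth e ij.2))],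
   [ffun i => lam (tnth e i)]).

Fixpoint rank_tp q k : k.-tuple G -> rank_type q k :=
  match q return k.-tuple G -> rank_type q k with
  | 0 => fun e => atomic_tp e
  | q'.+1 => fun e => [set rank_tp q' [tuple of z :: e] | z in G]
  end.

Lemma zip_tnth k (e e' : k.-tuple G) p :
  p \in zip e e' -> exists i, p = (tnth e i, tnth e' i).
Proof.
case: p => a b /(nthP (a, b))[i ik <-].
have sz : size (zip e e') = k by rewrite size_zip !size_tuple minnn.
rewrite sz in ik; exists (Ordinal ik).
by rewrite nth_zip ?size_tuple // (tnth_nth a) (tnth_nth b).
Qed.

Lemma rank_tp_game_equiv q k (e e' : k.-tuple G) :
  rank_tp q e = rank_tp q e' -> game_equiv q (zip e e').
Proof.
elim: q k e e' => [|q IH] k e e' /=.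
  move=> [/ffunP He /ffunP Hc]; split.
    by move=> p /zip_tnth[i ->]; have := Hc i; rewrite !ffunE.
  move=> p p' /zip_tnth[i ->] /zip_tnth[j ->].
  by have := He (i, j); rewrite !ffunE /= => -[].
move=> E; split=> z.
  have : rank_tp q [tuple of z :: e] \in [set rank_tp q [tuple of z :: e'] | z in G].
    by rewrite -E; apply/imsetP; exists z.
  by move=> /imsetP[z' _ /IH]; exists z'.
have : rank_tp q [tuple of z :: e'] \in [set rank_tp q [tuple of z :: e] | z in G].
  by rewrite E; apply/imsetP; exists z.
by move=> /imsetP[z' _ /esym/IH]; exists z'.
Qed.

End Game.

Section Induced.
Variables (G : sgraph) (M : pred G).

Definition induced_vertex : finType := {x : G | M x}.
Definition induced_edge : rel induced_vertex := fun x y => edge (val x) (val y).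

Lemma induced_edge_sym : symmetric induced_edge.
Proof. by move=> x y; apply: edge_sym. Qed.

Lemma induced_edge_irrefl : irreflexive induced_edge.
Proof. by move=> x; apply: edge_irrefl. Qed.

Definition induced : sgraph := SGraph induced_edge_sym induced_edge_irrefl.

(* Duplicator answers inside [M] by the strategy of the smaller game and copies
   Spoiler's moves outside [M]. *)
Lemma game_equiv_induced (C C' : finType) (lam : G -> C) (lam' : induced -> C') :
  (forall u v : induced, lam' u = lam' v -> lam (val u) = lam (val v)) ->
  (forall (u v : induced) w, lam' u = lam' v -> ~~ M w ->
     edge (val u) w = edge (val v) w) ->
  forall q (s : seq (induced * induced)) (s' : seq (G * G)),
    (forall p, p \in s' -> (exists2 p0, p0 \in s & p = (val p0.1, val p0.2))
                           \/ p.1 = p.2 /\ ~~ M p.1) ->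
    game_equiv lam' q s -> game_equiv lam q s'.
Proof.
move=> Hlam Hadj; elim=> [|q IH] s s' Hs.
  move=> [Hc He]; split.
    move=> p /Hs[[p0 sp0 ->]|[-> //]] /=; exact/Hlam/Hc.
  have ne (u : induced) w : ~~ M w -> (val u == w) = false.
    by move=> Mw; apply: contraNF Mw => /eqP <-; exact: valP.
  move=> p p' /Hs[[p0 sp0 ->]|[E Mp]] /Hs[[p1 sp1 ->]|[E' Mp']] /=.
  - exact: He.
  - rewrite -E' !ne //; split=> //; apply: Hadj => //; exact: Hc.
  - rewrite -E !(eq_sym p.1) !ne // !(edge_sym p.1); split=> //.
    by apply: Hadj => //; exact: Hc.
  - by rewrite E E'.
have keep (p0 : induced * induced) : forall p, p \in (val p0.1, val p0.2) :: s' ->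
    (exists2 p1, p1 \in p0 :: s & p = (val p1.1, val p1.2)) \/ p.1 = p.2 /\ ~~ M p.1.
  move=> p; rewrite inE => /orP[/eqP->|/Hs[[p1 sp1 ->]|]]; last by right.
    by left; exists p0 => //; rewrite mem_head.
  by left; exists p1 => //; rewrite inE sp1 orbT.
have keep' w : ~~ M w -> forall p, p \in (w, w) :: s' ->
    (exists2 p1, p1 \in s & p = (val p1.1, val p1.2)) \/ p.1 = p.2 /\ ~~ M p.1.
  by move=> Mw p; rewrite inE => /orP[/eqP->|/Hs //]; right.
(* A move outside [M] uses up a round but leaves the position inside [M] unchanged. *)
move=> H; have Hq : game_equiv lam' q s by exact: (game_equiv_leq (leqnSn q)).
case: H => H1 H2; split=> x; have [Mx|Mx] := boolP (M x).
- have [y /(IH _ ((x, val y) :: s'))] := H1 (exist _ x Mx).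
  by move=> Hy; exists (val y); apply: Hy; exact: (keep (exist _ x Mx, y)).
- by exists x; apply: IH Hq; exact: keep'.
- have [y /(IH _ ((val y, x) :: s'))] := H2 (exist _ x Mx).
  by move=> Hy; exists (val y); apply: Hy; exact: (keep (y, exist _ x Mx)).
- by exists x; apply: IH Hq; exact: keep'.
Qed.

End Induced.

(** * Weak locality *)

(** Numbering a bounded set turns its subsets into labels from a type that depends on [N] alone. The
    extra index makes this type nonempty, so that [idx] is total. *)
Lemma bounded_index (T : finType) (S : {set T}) N : #|S| <= N ->
  exists idx : T -> 'I_N.+1, {in S &, injective idx}.
Proof.
move=> SN; exists (fun s => inord (index s (enum S))) => s s' sS s'S /(congr1 val) /=.
have lt u : u \in S -> index u (enum S) < N.+1.
  by move=> uS; rewrite ltnS (leq_trans (index_size _ _)) // -cardE.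
rewrite !inordK ?lt // => E.
have nthS u : u \in S -> nth s (enum S) (index u (enum S)) = u.
  by move=> uS; rewrite nth_index ?mem_enum.
by rewrite -[LHS]nthS // E nthS.
Qed.

Section WeakLocality.
Variable G : sgraph.

(** [sg] assigns each position of a tuple to one of two sides. *)
Definition agree k (sg : k.-tuple bool) b (e e' : k.-tuple G) :=
  forall i, tnth sg i = b -> tnth e i = tnth e' i.

Definition far k (sg : k.-tuple bool) r (e : k.-tuple G) :=
  forall i j, tnth sg i -> tnth sg j = false ->
    ~~ dist_le r (tnth e i) (tnth e j).

(* A weak form of Gaifman locality: when the two sides are far apart, [f] is a
   function of an [A]-valued label of one side and a [B]-valued label of the
   other.  The labels themselves are arbitrary functions of the sides. *)
Definition splits k (X : Type) (f : k.-tuple G -> X) r (A B : finType) :=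
  forall sg : k.-tuple bool,
  exists (al : k.-tuple G -> A) (be : k.-tuple G -> B),
    [/\ forall e e', agree sg true e e' -> al e = al e',
        forall e e', agree sg false e e' -> be e = be e'
      & forall e e', far sg r e -> far sg r e' ->
          al e = al e' -> be e = be e' -> f e = f e'].

(** Take a largest subset of [Z] with at most [k.+1] elements and pairwise distances above [2 * r].
    If every element of it is within [r] of an entry of [e], it has at most [k] elements, so by
    maximality [z] is within [2 * r] of one of them, hence within [3 * r] of [e]. *)
Lemma scattered_witnesses r k (Z : {set G}) :
  exists S : {set G}, [/\ S \subset Z, #|S| <= k.+1 &
    forall (e : k.-tuple G) z, z \in Z -> (forall i, ~~ dist_le r z (tnth e i)) ->
      (exists2 s, s \in S & forall i, ~~ dist_le r s (tnth e i)) \/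
      exists i, dist_le (3 * r) z (tnth e i)].
Proof.
pose scat (A : {set G}) := [&& A \subset Z, #|A| <= k.+1 &
  [forall a in A, forall b in A, (a != b) ==> ~~ dist_le (2 * r) a b]].
have scat0 : scat set0.
  by rewrite /scat sub0set cards0 /=; apply/forall_inP => a; rewrite inE.
case: (arg_maxnP (fun A : {set G} => #|A|) scat0) => S /and3P[SZ Sk /forall_inP Ssc] Smax.
exists S; split=> // e z zZ zfar.
case: (boolP [exists s in S, [forall i, ~~ dist_le r s (tnth e i)]]).
  by move=> /exists_inP[s sS /forallP sfar]; left; exists s.
rewrite negb_exists_in => /forall_inP Snear; right.
have near s : s \in S -> exists i, dist_le r s (tnth e i).
  by move=> /Snear; rewrite negb_forall => /existsP[i]; rewrite negbK; exists i.
have sc a b : a \in S -> b \in S -> dist_le (2 * r) a b -> a = b.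
  move=> aS bS ab; have /forall_inP/(_ b bS) := Ssc a aS.
  by rewrite ab implybF negbK => /eqP.
(* Two elements of [S] near the same entry of [e] would be within [2 * r] of each other, so choosing
   a near entry is injective. *)
have Slt : #|S| <= k.
  pose c s := odflt None (omap Some [pick i | dist_le r s (tnth e i)]).
  have cP s : s \in S -> exists2 i, c s = Some i & dist_le r s (tnth e i).
    move=> /near[i si]; rewrite /c; case: pickP => [j sj|/(_ i)]; last by rewrite si.
    by exists j.
  have cinj : {in S &, injective c}.
    move=> a b aS bS; have [i -> ai] := cP a aS; have [j -> bj] := cP b bS.
    move=> [ij]; apply: sc => //; rewrite mul2n -addnn.
    by apply: dist_le_trans ai _; rewrite dist_le_sym ij.
  have cS : c @: S \subset Some @: [set: 'I_k].
    apply/subsetP => _ /imsetP[s sS ->]; have [i -> _] := cP s sS.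
    by rewrite imset_f.
  rewrite -(card_in_imset cinj) (leq_trans (subset_leq_card cS)) //.
  by rewrite (leq_trans (leq_imset_card _ _)) // cardsT card_ord.
have [s sS zs] : exists2 s, s \in S & dist_le (2 * r) z s.
  case: (boolP [exists s in S, dist_le (2 * r) z s]) => [/exists_inP//|].
  rewrite negb_exists_in => /forall_inP zS.
  have zNS : z \notin S by apply/negP => /zS; rewrite dist_le_refl.
  have : scat (z |: S).
    apply/and3P; split; first by rewrite subUset sub1set zZ.
      by rewrite cardsU1 zNS.
    apply/forall_inP => a; rewrite in_setU1 => /predU1P aS.
    apply/forall_inP => b; rewrite in_setU1 => /predU1P bS.
    apply/implyP => ab; apply/negP => dab.
    case: aS bS => [aE|aS] [bE|bS].
    - by rewrite aE bE eqxx in ab.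
    - by have := zS _ bS; rewrite -aE dab.
    - by have := zS _ aS; rewrite dist_le_sym -bE dab.
    - by rewrite (sc a b) ?eqxx in ab.
  by move=> /Smax /=; rewrite cardsU1 zNS ltnn.
have [i si] := near s sS; exists i.
by rewrite (_ : 3 * r = 2 * r + r); [apply: dist_le_trans si | lia].
Qed.

(** Each side is labelled by its own atomic type. Across the sides, distance above 1 excludes both
    equality and adjacency. *)
Lemma splits_atomic (C : finType) (lam : G -> C) k :
  splits (@atomic_tp G C lam k) 1
    ({ffun 'I_k * 'I_k -> bool * bool} * {ffun 'I_k -> option C})%type
    ({ffun 'I_k * 'I_k -> bool * bool} * {ffun 'I_k -> option C})%type.
Proof.
move=> sg.
pose part b (e : k.-tuple G) :=
  ([ffun ij : 'I_k * 'I_k => if (tnth sg ij.1 == b) && (tnth sg ij.2 == b)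
      then (atomic_tp lam e).1 ij else (false, false)],
   [ffun i => if tnth sg i == b then Some (lam (tnth e i)) else None]).
have partE b e e' : agree sg b e e' -> part b e = part b e'.
  move=> ee'; congr pair; apply/ffunP => i; rewrite !ffunE.
    by case: ifP => // /andP[/eqP/ee' -> /eqP/ee' ->].
  by case: ifP => // /eqP/ee' ->.
exists (part true), (part false); split; [exact: partE|exact: partE|].
move=> e e' efar e'far [/ffunP Et /ffunP Ct] [/ffunP Ef /ffunP Cf].
have cross e0 : far sg 1 e0 -> forall i j, tnth sg i != tnth sg j ->
    (tnth e0 i == tnth e0 j, edge (tnth e0 i) (tnth e0 j)) = (false, false).
  move=> far0; suff H i j : tnth sg i -> tnth sg j = false ->
      (tnth e0 i == tnth e0 j) = false /\ edge (tnth e0 i) (tnth e0 j) = false.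
    move=> i j; case Ei: (tnth sg i); case Ej: (tnth sg j) => // _.
      by case: (H i j Ei Ej) => -> ->.
    by rewrite eq_sym edge_sym; case: (H j i Ej Ei) => -> ->.
  move=> Ei Ej; have Fij := far0 i j Ei Ej; split; apply: contraNF Fij.
    by move/eqP->; exact: dist_le_refl.
  exact: dist_le_edge.
congr pair; apply/ffunP => i.
  case: i => i j; have := Et (i, j); have := Ef (i, j); rewrite !ffunE /=.
  case: (altP (tnth sg i =P tnth sg j)) => [<-|ij].
    by case: (tnth sg i).
  by rewrite !cross.
by have := Ct i; have := Cf i; rewrite !ffunE; case: (tnth sg i) => [_ []|[]].
Qed.

(** With [f] the type of rank [q], this is the type of rank [q.+1]. *)
Definition extensions k (X : finType) (f : k.+1.-tuple G -> X) (e : k.-tuple G) :=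
  [set f [tuple of z :: e] | z in G].

Definition near k (sg : k.-tuple bool) b r (e : k.-tuple G) : {set G} :=
  [set z | [exists i, (tnth sg i == b) && dist_le r z (tnth e i)]].

Lemma near_agree k (sg : k.-tuple bool) b r e e' :
  agree sg b e e' -> near sg b r e = near sg b r e'.
Proof.
move=> ee'; apply/setP => z; rewrite !inE; apply: eq_existsb => i.
by case: eqP => //= /ee' ->.
Qed.

Lemma nearP k (sg : k.-tuple bool) b r (e : k.-tuple G) z :
  reflect (exists2 i, tnth sg i = b & dist_le r z (tnth e i)) (z \in near sg b r e).
Proof.
rewrite inE; apply: (iffP existsP) => [[i /andP[/eqP]]|[i <- zi]]; exists i => //.
by rewrite eqxx.
Qed.

Lemma agree_cons k (sg : k.-tuple bool) b c (e e' : k.-tuple G) z :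
  agree sg b e e' -> agree [tuple of c :: sg] b [tuple of z :: e] [tuple of z :: e'].
Proof.
move=> ee' i; case: (unliftP ord0 i) => [j|] ->; rewrite ?tnth0 //.
by rewrite !tnthS; apply: ee'.
Qed.

Lemma agree_behead k (sg : k.-tuple bool) b (e : k.-tuple G) z z' :
  agree [tuple of ~~ b :: sg] b [tuple of z :: e] [tuple of z' :: e].
Proof.
by move=> i; case: (unliftP ord0 i) => [j|] ->; rewrite ?tnth0 ?tnthS //; case: b.
Qed.

Lemma far_mono k (sg : k.-tuple bool) m n e : m <= n -> far sg n e -> far sg m e.
Proof.
by move=> mn en i j Ei Ej; apply: contra (en i j Ei Ej); exact: dist_le_mono.
Qed.

Lemma far_cons k (sg : k.-tuple bool) b r e z :
  far sg r e ->
  (forall i, tnth sg i = ~~ b -> ~~ dist_le r z (tnth e i)) ->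
  far [tuple of b :: sg] r [tuple of z :: e].
Proof.
move=> efar zfar i j.
case: (unliftP ord0 i) => [i'|] ->; case: (unliftP ord0 j) => [j'|] ->;
  rewrite ?tnth0 ?tnthS; first exact: efar.
- by move=> Ei bF; rewrite dist_le_sym; apply: zfar; rewrite bF.
- by move=> bT Ej; apply: zfar; rewrite bT.
- by move=> ->.
Qed.

(** By the triangle inequality: [4 * r] leaves [r] after the [3 * r] within which
    [scattered_witnesses] places a witness. *)
Lemma near_far_cons k (sg : k.-tuple bool) b r e z :
  far sg (4 * r) e -> z \in near sg b (3 * r) e ->
  far [tuple of b :: sg] r [tuple of z :: e].
Proof.
move=> efar /nearP[j Ej zj].
apply: far_cons => [|i Ei]; first by apply: far_mono efar; lia.
apply/negP => zi; have ji : dist_le (4 * r) (tnth e j) (tnth e i).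
  rewrite (_ : 4 * r = 3 * r + r); last by lia.
  by apply: dist_le_trans zi; rewrite dist_le_sym.
case: b Ej Ei => Ej Ei; first by have := efar j i Ej Ei; rewrite ji.
by have := efar i j Ei Ej; rewrite dist_le_sym ji.
Qed.

(* Up to the value of [f], a witness [z] can be taken near [e] or in a bounded
   set [S] independent of [e]: if [z] is far from [e], then [f] sees only its
   label, and [S] contains well-separated vertices of each label. *)
Lemma splits_extensions k (X : finType) (f : k.+1.-tuple G -> X) r
    (A B : finType) :
  splits f r A B ->
  splits (extensions f) (4 * r)
    ({set A} * {set A} * {set 'I_(#|A| * k.+1).+1})%type
    ({set B} * {set B} * {set 'I_(#|A| * k.+1).+1 * B})%type.
Proof.
move=> fspl.
(* Here the new vertex is alone on its side, so [al0] labels it independently of [e]. *)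
have [al0 [be0 [al0P be0P f0P]]] := fspl [tuple of true :: nseq k false].
pose Z t := [set z : G | [exists e : k.-tuple G, al0 [tuple of z :: e] == t]].
have /fin_all_exists[W WP] := fun t => scattered_witnesses r k (Z t).
pose S := \bigcup_t W t; pose N := #|A| * k.+1.
have SN : #|S| <= N.
  have : #|S| <= \sum_t #|W t|.
    rewrite /S; elim/big_rec2: _ => [|t m U _ le]; first by rewrite cards0.
    by rewrite (leq_trans (leq_card_setU _ _)) // leq_add2l.
  move/leq_trans; apply; rewrite /N -sum_nat_const; apply: leq_sum => t _.
  by have [] := WP t.
have al0E z (e e' : k.-tuple G) : al0 [tuple of z :: e] = al0 [tuple of z :: e'].
  apply: al0P => i; case: (unliftP ord0 i) => [j|] ->; rewrite ?tnth0 // !tnthS.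
  by rewrite tnth_nseq.
(* A witness far from [e] is exchanged for an element of [S] with the same label [al0] that is also
   far from [e]. *)
have SP (e : k.-tuple G) z : (exists i, dist_le (3 * r) z (tnth e i)) \/
    exists2 s, s \in S & f [tuple of z :: e] = f [tuple of s :: e].
  case: (boolP [exists i, dist_le (3 * r) z (tnth e i)]) => [/existsP|]; first by left.
  rewrite negb_exists => /forallP zfar; right.
  have zfar' i : ~~ dist_le r z (tnth e i).
    by apply: contra (zfar i); apply: dist_le_mono; lia.
  have farS s : (forall i, ~~ dist_le r s (tnth e i)) ->
      far [tuple of true :: nseq k false] r [tuple of s :: e].
    move=> sfar i j; case: (unliftP ord0 i) => [i'|] ->; rewrite ?tnth0 ?tnthS.
      by rewrite tnth_nseq.
    by move=> _; case: (unliftP ord0 j) => [j'|] -> //; rewrite tnthS.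
  have zZ : z \in Z (al0 [tuple of z :: e]) by rewrite inE; apply/existsP; exists e.
  have [WZ _ Wfar] := WP (al0 [tuple of z :: e]).
  case: (Wfar e z zZ zfar') => [[s sW sfar]|[i zi]]; last by have := zfar i; rewrite zi.
  exists s; first by apply/bigcupP; exists (al0 [tuple of z :: e]).
  apply: f0P; [exact: farS|exact: farS| |].
    have /(subsetP WZ) := sW; rewrite inE => /existsP[e' /eqP <-]; exact: al0E.
  by apply: be0P => i; case: (unliftP ord0 i) => [j|] ->; rewrite ?tnth0 ?tnthS.
have [idx idxK] := bounded_index SN.
move=> sg.
have [al1 [be1 [al1P be1P f1P]]] := fspl [tuple of true :: sg].
have [al2 [be2 [al2P be2P f2P]]] := fspl [tuple of false :: sg].
(* Witnesses near the true side join that side; those near the false side, and those in [S] not near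
   the true side, join the false side. The middle components have at most one element, because [al2]
   ignores a new vertex on the false side and [be1] one on the true side. *)
pose al (e : k.-tuple G) := ([set al1 [tuple of z :: e] | z in near sg true (3 * r) e],
                  [set al2 [tuple of z :: e] | z in G],
                  [set idx s | s in [set s in S | s \notin near sg true r e]]).
pose be (e : k.-tuple G) := ([set be2 [tuple of z :: e] | z in near sg false (3 * r) e],
                  [set be1 [tuple of z :: e] | z in G],
                  [set (idx s, be2 [tuple of s :: e]) | s in S]).
exists al, be; split.
- move=> e e' ee'; rewrite /al; congr (_, _, _).
  + rewrite (near_agree _ ee'); apply: eq_in_imset => z _; exact/al1P/agree_cons.
  + by apply: eq_in_imset => z _; exact/al2P/agree_cons.
  + by rewrite (near_agree _ ee').
- move=> e e' ee'; rewrite /be; congr (_, _, _).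
  + rewrite (near_agree _ ee'); apply: eq_in_imset => z _; exact/be2P/agree_cons.
  + by apply: eq_in_imset => z _; exact/be1P/agree_cons.
  + by apply: eq_in_imset => s _; congr pair; exact/be2P/agree_cons.
suff H e e' : far sg (4 * r) e -> far sg (4 * r) e' -> al e = al e' -> be e = be e' ->
    extensions f e \subset extensions f e'.
  move=> e e' ef e'f ea eb; apply/eqP; rewrite eqEsubset.
  by rewrite (H e e' ef e'f ea eb) (H e' e e'f ef (esym ea) (esym eb)).
move=> ef e'f [A1 A2 A3] [B1 B2 B3]; apply/subsetP => _ /imsetP[z _ ->].
have be1E u u' : be1 [tuple of u :: e] = be1 [tuple of u' :: e'].
  have : be1 [tuple of u' :: e'] \in [set be1 [tuple of z :: e] | z in G].
    by rewrite B2; apply/imsetP; exists u'.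
  by move=> /imsetP[v _ ->]; apply: be1P; exact: (agree_behead (b := false)).
have al2E u u' : al2 [tuple of u :: e] = al2 [tuple of u' :: e'].
  have : al2 [tuple of u' :: e'] \in [set al2 [tuple of z :: e] | z in G].
    by rewrite A2; apply/imsetP; exists u'.
  by move=> /imsetP[v _ ->]; apply: al2P; exact: (agree_behead (b := true)).
have tcase u : u \in near sg true (3 * r) e -> f [tuple of u :: e] \in extensions f e'.
  move=> nu.
  have : al1 [tuple of u :: e] \in
      [set al1 [tuple of z :: e] | z in near sg true (3 * r) e].
    by apply/imsetP; exists u.
  rewrite A1 => /imsetP[u' nu' Eal]; apply/imsetP; exists u' => //.
  by apply: f1P => //; apply: near_far_cons.
have fcase u : u \in near sg false (3 * r) e -> f [tuple of u :: e] \in extensions f e'.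
  move=> nu.
  have : be2 [tuple of u :: e] \in
      [set be2 [tuple of z :: e] | z in near sg false (3 * r) e].
    by apply/imsetP; exists u.
  rewrite B1 => /imsetP[u' nu' Ebe]; apply/imsetP; exists u' => //.
  by apply: f2P => //; apply: near_far_cons.
case: (SP e z) => [[i zi]|[s sS ->]].
  case Ei: (tnth sg i); [apply: tcase|apply: fcase];
  by apply/nearP; exists i.
case: (boolP (s \in near sg true r e)) => [/nearP[i Ei si]|sN].
  apply: tcase; apply/nearP; exists i => //.
  by apply: dist_le_mono si; lia.
have sN' : s \notin near sg true r e'.
  have : idx s \in [set idx s | s in [set s in S | s \notin near sg true r e]].
    by apply: imset_f; rewrite inE sS.
  rewrite A3 => /imsetP[s']; rewrite inE => /andP[s'S Ns'] /idxK E.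
  by rewrite E.
apply/imsetP; exists s => //; apply: f2P.
- apply: far_cons; first by apply: far_mono ef; lia.
  by move=> i Ei; apply: contra sN => si; apply/nearP; exists i.
- apply: far_cons; first by apply: far_mono e'f; lia.
  by move=> i Ei; apply: contra sN' => si; apply/nearP; exists i.
- exact: al2E.
have : (idx s, be2 [tuple of s :: e]) \in [set (idx s, be2 [tuple of s :: e]) | s in S].
  by apply/imsetP; exists s.
by rewrite B3 => /imsetP[s' s'S [/idxK E ->]]; rewrite E.
Qed.
End WeakLocality.

Lemma splits_rank_tp (C : finType) q k : exists r (A B : finType),
  forall (G : sgraph) (lam : G -> C), splits (@rank_tp G C lam q k) r A B.
Proof.
elim: q k => [|q IH] k.
  by do 3!eexists; move=> G lam; exact: splits_atomic.
have [r [A [B IHk]]] := IH k.+1.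
by do 3!eexists; move=> G lam; apply: splits_extensions; exact: IHk.
Qed.

Lemma game_equiv_far (C : finType) q : exists r (A B : finType),
  forall (G : sgraph) (lam : G -> C), exists (al : G -> A) (be : G -> B),
  forall x y x' y', ~~ dist_le r x y -> ~~ dist_le r x' y' ->
    al x = al x' -> be y = be y' -> game_equiv lam q [:: (x, x'); (y, y')].
Proof.
have [r [A [B spl]]] := splits_rank_tp C q 2; exists r, A, B => G lam.
have [al [be [alP beP fP]]] := spl G lam [tuple true; false].
have farxy (x y : G) : ~~ dist_le r x y -> far [tuple true; false] r [tuple x; y].
  move=> xy i j; case: (unliftP ord0 i) => [i'|] ->; rewrite ?tnth0 ?tnthS.
    by rewrite (tnth_nth false) /=; case: i' => [[]].
  case: (unliftP ord0 j) => [j'|] -> //; rewrite !tnthS => _.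
  by rewrite (ord1 j').
(* [al] sees only the first entry and [be] only the second, so both can be evaluated on the
   diagonal. *)
exists (fun x => al [tuple x; x]), (fun y => be [tuple y; y]).
move=> x y x' y' xy x'y' ea eb.
apply: (@rank_tp_game_equiv _ _ _ _ 2 [tuple x; y] [tuple x'; y']).
apply: fP; [exact: farxy|exact: farxy| |].
  suff E u v w : al [tuple u; v] = al [tuple u; w] by rewrite (E x y x) (E x' y' x').
  apply: alP => i; case: (unliftP ord0 i) => [j|] -> //.
  by rewrite tnthS (ord1 j).
suff E u v w : be [tuple u; w] = be [tuple v; w] by rewrite (E x y y) (E x' y' y').
apply: beP => i; case: (unliftP ord0 i) => [j|] -> //.
by rewrite !tnthS.
Qed.

(** * Representations and interval decompositions *)

Fixpoint quantifier_rank U n (phi : formula U n) : nat :=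
  match phi with
  | FNot _ f => quantifier_rank f
  | FAnd _ f g | FOr _ f g => maxn (quantifier_rank f) (quantifier_rank g)
  | FExists _ f | FForall _ f => (quantifier_rank f).+1
  | _ => 0
  end.

(** The type of colors is arbitrary, possibly infinite; only these finitely many enter a finite
    label. *)
Fixpoint formula_colors U n (phi : formula U n) : seq U :=
  match phi with
  | FColor _ u _ => [:: u]
  | FNot _ f | FExists _ f | FForall _ f => formula_colors f
  | FAnd _ f g | FOr _ f g => formula_colors f ++ formula_colors g
  | _ => [::]
  end.

(** Duplicator answers [(v, i)] by [(v', i)], where [v'] answers [v] in [G]: equality and adjacency
    in the copy depend only on those in [G] and on the copy indices. *)
Lemma sat_copy_game (U : Type) (G : sgraph) k (c : expansion U (copy k G))
    (C : finType) (lam : G -> C) n (phi : formula U n) :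
  (forall u, List.In u (formula_colors phi) -> forall v v' i, lam v = lam v' ->
     c u (v, i) = c u (v', i)) ->
  forall q s (e e' : n.-tuple (copy k G)),
    quantifier_rank phi <= q -> game_equiv lam q s ->
    (forall i, (tnth e i).2 = (tnth e' i).2 /\
               ((tnth e i).1, (tnth e' i).1) \in s) ->
    sat c phi e = sat c phi e'.
Proof.
have atom n0 q s (e e' : n0.-tuple (copy k G)) : game_equiv lam q s ->
    (forall i, (tnth e i).2 = (tnth e' i).2 /\
               ((tnth e i).1, (tnth e' i).1) \in s) ->
    forall i j, ((tnth e i).1 == (tnth e j).1) = ((tnth e' i).1 == (tnth e' j).1) /\
      edge (tnth e i).1 (tnth e j).1 = edge (tnth e' i).1 (tnth e' j).1.
  move=> /game_equiv_partial_iso[_ He] es i j.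
  exact: (He (_, _) (_, _) (proj2 (es i)) (proj2 (es j))).
have cons n0 s (e e' : n0.-tuple (copy k G)) v v' i :
    (forall i, (tnth e i).2 = (tnth e' i).2 /\ ((tnth e i).1, (tnth e' i).1) \in s) ->
    forall j, (tnth [tuple of (v, i) :: e] j).2 = (tnth [tuple of (v', i) :: e'] j).2 /\
      ((tnth [tuple of (v, i) :: e] j).1, (tnth [tuple of (v', i) :: e'] j).1)
        \in (v, v') :: s.
  move=> es j; case: (unliftP ord0 j) => [j'|] ->; rewrite ?tnth0 ?tnthS /=.
    by rewrite inE; case: (es j') => -> ->; rewrite orbT.
  by rewrite mem_head.
elim: phi => {n} [n|n i j|n i j|n u i|n f IHf|n f IHf g IHg|n f IHf g IHg|n f IHf|n f IHf]
  /= Hc q s e e' rk Hq es.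
- by [].
- have [E _] := atom _ _ _ _ _ Hq es i j; have [Ei _] := es i; have [Ej _] := es j.
  have eqE (x y : copy k G) : (x == y) = (x.1 == y.1) && (x.2 == y.2) by [].
  by rewrite !eqE E Ei Ej.
- have [E E'] := atom _ _ _ _ _ Hq es i j; have [Ei _] := es i; have [Ej _] := es j.
  by rewrite /copy_edge E E' Ei Ej.
- have [Ei si] := es i; have /game_equiv_partial_iso[/(_ _ si)/= El _] := Hq.
  rewrite [tnth e i]surjective_pairing [tnth e' i]surjective_pairing -Ei.
  by apply: Hc El; left.
- by rewrite (IHf _ q s e e').
- rewrite geq_max in rk; case/andP: rk => rkf rkg.
  have Hf u := fun uf => Hc u (proj2 (List.in_app_iff _ _ u) (or_introl uf)).
  have Hg u := fun ug => Hc u (proj2 (List.in_app_iff _ _ u) (or_intror ug)).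
  by rewrite (IHf Hf q s e e') ?(IHg Hg q s e e').
- rewrite geq_max in rk; case/andP: rk => rkf rkg.
  have Hf u := fun uf => Hc u (proj2 (List.in_app_iff _ _ u) (or_introl uf)).
  have Hg u := fun ug => Hc u (proj2 (List.in_app_iff _ _ u) (or_intror ug)).
  by rewrite (IHf Hf q s e e') ?(IHg Hg q s e e').
- case: q rk Hq => // q rk [H1 H2].
  apply/existsP/existsP => -[[v i] H].
    have [v' Hv] := H1 v; exists (v', i).
    by rewrite -(IHf Hc q _ [tuple of (v, i) :: e] _ rk Hv (cons _ _ _ _ _ _ _ es)).
  have [v' Hv] := H2 v; exists (v', i).
  by rewrite (IHf Hc q _ _ [tuple of (v, i) :: e'] rk Hv (cons _ _ _ _ _ _ _ es)).
- case: q rk Hq => // q rk [H1 H2].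
  apply/forallP/forallP => H [v i].
    have [v' Hv] := H2 v.
    by rewrite -(IHf Hc q _ _ _ rk Hv (cons _ _ _ _ _ _ i es)).
  have [v' Hv] := H1 v.
  by rewrite (IHf Hc q _ _ _ rk Hv (cons _ _ _ _ _ _ i es)).
Qed.

(* The semantic counterpart of transducing [F] from a colored copy of [H]: no
   formula is fixed, the edges of [F] are merely invariant under the game. *)
Definition represents q (C K : finType) (F H : sgraph) : Prop :=
  exists (lam : H -> C) (h : F -> H) (kap : F -> K),
    (forall x y, h x = h y -> kap x = kap y -> x = y) /\
    forall x y x' y', kap x = kap x' -> kap y = kap y' ->
      game_equiv lam q [:: (h x, h x'); (h y, h y')] -> edge x y = edge x' y'.

Lemma transduce_represents (T : transduction) : exists q (C K : finType),
  forall (D : graph_class) F, transduce T D F ->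
    exists2 H, D H & represents q C K F H.
Proof.
case: T => k k0 U I; pose us := formula_colors (eta I).
exists (quantifier_rank (eta I)), {ffun 'I_(size us) * 'I_k -> bool}, 'I_k.
move=> D F [H DH [c [f [bij_f fE]]]]; exists H => //.
(* The label of a vertex records the relevant colors of all its copies. *)
pose lam (v : H) := [ffun ui : 'I_(size us) * 'I_k => c (tnth (in_tuple us) ui.1) (v, ui.2)].
exists lam, (fun x => (val (f x)).1), (fun x => (val (f x)).2); split.
  move=> x y E1 E2; apply: (bij_inj bij_f); apply: val_inj.
  by rewrite [LHS]surjective_pairing E1 E2 -surjective_pairing.
move=> x y x' y' Ex Ey Hq; rewrite -!fE /= /interp_edge.
apply: (sat_copy_game _ (leqnn _) Hq).
  move=> u; rewrite -/us => uus v v' i /ffunP E.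
  suff [j <-] : exists j, tnth (in_tuple us) j = u.
    by have := E (j, i); rewrite !ffunE.
  have [j [/ltP jl jE]] := List.In_nth us u u uus; exists (Ordinal jl).
  rewrite (tnth_nth u) /= -[RHS]jE.
  by elim: (us) (j) => [|a l IH] [|j'] //=.
move=> i; case: (unliftP ord0 i) => [j|] ->; last by rewrite !tnth0 mem_head.
by rewrite !tnthS (ord1 j) !tnth0; split=> //; rewrite in_cons mem_head orbT.
Qed.

(* [bags w G]: [G] has a path decomposition, given by intervals, whose bags have
   at most [w] vertices, i.e. of width [w - 1]. *)
Definition bags (w : nat) (G : sgraph) : Prop :=
  exists lo hi : G -> R,
    [/\ forall x, Rle (lo x) (hi x),
        forall x y, edge x y -> exists t,
          [/\ Rle (lo x) t, Rle t (hi x), Rle (lo y) t & Rle t (hi y)]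
      & forall t (A : {set G}),
          (forall x, x \in A -> Rle (lo x) t /\ Rle t (hi x)) -> #|A| <= w].

(** Intervals through a common point form a clique. *)
Lemma pathwidth_le_bags n G : pathwidth_le n G -> bags n.+1 G.
Proof.
move=> [w [[H [[lo [hi [lohi inter]]] [f [f_inj fE]] wE]] _] wn].
have omega : clique_number H <= n.+1 by rewrite wE in wn; lia.
exists (lo \o f), (hi \o f); split=> [x|x y /fE fxy|t A At] //=.
  by apply/inter => //; apply: contraTneq fxy => ->; rewrite edge_irrefl.
rewrite -(card_imset _ f_inj) (leq_trans _ omega) //.
apply: (@leq_bigmax_cond _ (fun A => clique A) (fun A : {set H} => #|A|)).
apply/forall_inP => _ /imsetP[x xA ->]; apply/forall_inP => _ /imsetP[y yA ->].
apply/implyP => xy; apply/inter => //; exists t.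
by have [] := At x xA; have [] := At y yA.
Qed.

(** * Cutting an interval decomposition around a set of bounded radius *)

Section Cut.
Variables (G : sgraph) (lo hi : G -> R).
Hypothesis lohi : forall x, Rle (lo x) (hi x).
Hypothesis meet : forall x y, edge x y -> exists t,
  [/\ Rle (lo x) t, Rle t (hi x), Rle (lo y) t & Rle t (hi y)].

(** Consecutive intervals along a path meet, so their union has no gaps. *)
Lemma path_cover u p t : path (@edge G) u p ->
  Rle (lo u) t \/ Rle (lo (last u p)) t -> Rle t (hi u) \/ Rle t (hi (last u p)) ->
  exists2 x, x \in u :: p & Rle (lo x) t /\ Rle t (hi x).
Proof.
elim: p u => [|z p IH] u /=.
  by move=> _ [lu|lu] [ru|ru]; exists u => //; rewrite mem_head.
move=> /andP[/meet[s [s1 s2 s3 s4]] zp] lt rt.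
have : Rle (lo u) t /\ Rle t (hi u) \/
    (Rle (lo z) t \/ Rle (lo (last z p)) t) /\ (Rle t (hi z) \/ Rle t (hi (last z p))).
  have [a|a] := Rle_or_lt (lo u) t; have [b|b] := Rle_or_lt t (hi u); [by left|right|right|].
  - by split; [left; lra|case: rt; [lra|right]].
  - by split; [case: lt; [lra|right]|left; lra].
  - by have := lohi u; lra.
move=> [ut|[lt' rt']]; first by exists u => //; rewrite mem_head.
by have [x xp xt] := IH z zp lt' rt'; exists x => //; rewrite inE xp orbT.
Qed.
End Cut.

Lemma exists_argmin (T : finType) (f : T -> R) (X : {set T}) x0 : x0 \in X ->
  exists2 x, x \in X & forall y, y \in X -> Rle (f x) (f y).
Proof.
move=> x0X.
suff [x xX xmin] : exists2 x, x \in X & forall y, y \in enum X -> Rle (f x) (f y).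
  by exists x => // y yX; apply: xmin; rewrite mem_enum.
have : {subset enum X <= X} by move=> y; rewrite mem_enum.
elim: (enum X) => [|a s IH] sX; first by exists x0.
have [y ys|x xX xs] := IH; first by apply: sX; rewrite inE ys orbT.
have aX : a \in X by apply: sX; rewrite mem_head.
have [ax|xa] := Rle_or_lt (f a) (f x); [exists a|exists x] => // y;
  rewrite inE => /orP[/eqP->|/xs]; lra.
Qed.

Definition Rleb x y : bool := if Rle_dec x y then true else false.

Lemma RlebP x y : reflect (Rle x y) (Rleb x y).
Proof. by rewrite /Rleb; case: Rle_dec => ?; constructor. Qed.

(** Paths from [v0] to the vertices of [X] whose intervals start first and end last cover the whole
    span [[a, b]] of [X]. Every point of the span thus lies in the interval of a vertex of [P], and
    deleting [P] lowers the bag size. An interval that leaves [[a, b]] but meets one inside contains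
    [a] or [b]. So [S] consists of two paths and two bags. *)
Lemma bags_cut w (G : sgraph) D (X : {set G}) v0 :
  bags w.+1 G -> v0 \in X -> (forall x, x \in X -> dist_le D v0 x) ->
  exists (M : pred G) (S : {set G}),
    [/\ #|S| <= 2 * D.+1 + 2 * w.+1, bags w (induced M),
        forall x, x \in X -> x \notin S -> M x
      & forall u v, M u -> ~~ M v -> edge u v -> v \in S].
Proof.
move=> [lo [hi [lohi meet bag]]] v0X XD.
have [x1 x1X lomin] := exists_argmin lo v0X.
have [x2 x2X himax] := exists_argmin (fun x => Ropp (hi x)) v0X.
have /dist_leP[p1 [vp1 p1x p1D]] := XD x1 x1X.
have /dist_leP[p2 [vp2 p2x p2D]] := XD x2 x2X.
pose a := lo x1; pose b := hi x2.
pose P := [set x in v0 :: p1] :|: [set x in v0 :: p2].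
pose bagset t := [set x | Rleb (lo x) t && Rleb t (hi x)].
have bagw t : #|bagset t| <= w.+1.
  by apply: (bag t) => x; rewrite inE => /andP[/RlebP ? /RlebP ?].
pose M : pred G := fun x => [&& Rleb a (lo x), Rleb (hi x) b & x \notin P].
exists M, (P :|: bagset a :|: bagset b); split.
- have cP : #|P| <= 2 * D.+1.
    have cp p : size p <= D -> #|[set x in v0 :: p]| <= D.+1.
      by move=> pD; rewrite cardsE (leq_trans (card_size _)).
    rewrite (leq_trans (leq_card_setU _ _)) // mul2n -addnn leq_add //; exact: cp.
  rewrite (leq_trans (leq_card_setU _ _)) //.
  have [Pa _] := leq_card_setU P (bagset a).
  by have := bagw a; have := bagw b; lia.
- exists (lo \o val), (hi \o val); split=> [x|x y /meet //|t A At] //=.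
  have [->|[x xA]] := set_0Vmem A; first by rewrite cards0.
  have [xt tx] := At x xA; have /and3P[/RlebP ax /RlebP xb _] := valP x.
  have [p pP [lp rp]] : exists2 p, p \in P & Rle (lo p) t /\ Rle t (hi p).
    have at_ : Rle a t := Rle_trans _ _ _ ax xt.
    have tb : Rle t b := Rle_trans _ _ _ tx xb.
    (* The path to [x1] covers from [a] to the end of the interval of [v0], and the path to [x2]
       covers the rest. *)
    have [tv|vt] := Rle_or_lt t (hi v0).
      have [||p pp pt] := path_cover lohi meet vp1 (t := t); rewrite ?p1x; auto.
      by exists p => //; rewrite !inE -in_cons pp.
    have [||p pp pt] := path_cover lohi meet vp2 (t := t); rewrite ?p2x; auto.
      by left; have := lohi v0; lra.
    by exists p => //; rewrite in_setU !in_set pp orbT.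
  have pN : p \notin val @: A.
    by apply: contraL pP => /imsetP[y _ ->]; have /and3P[] := valP y.
  have : #|p |: val @: A| <= w.+1.
    apply: (bag t) => y; rewrite in_setU1 => /predU1P[-> //|/imsetP[z zA ->]].
    exact: At.
  by rewrite cardsU1 pN card_imset //; exact: val_inj.
- move=> x xX; rewrite !in_setU !negb_or => /andP[/andP[xP _] _]; apply/and3P; split.
  + by apply/RlebP; exact: lomin.
  + by apply/RlebP; have := himax x xX; rewrite /b; lra.
  + by rewrite /P in_setU negb_or.
move=> u v /and3P[/RlebP au /RlebP ub uP] vM /meet[t [t1 t2 t3 t4]].
rewrite !in_setU; case: (boolP (v \in P)) => [|vP]; first by rewrite in_setU => ->.
move: vM; rewrite /M vP andbT negb_and => /orP[/RlebP va|/RlebP bv].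
  apply/orP; left; apply/orP; right; rewrite inE; apply/andP; split; apply/RlebP; lra.
by apply/orP; right; rewrite inE; apply/andP; split; apply/RlebP; lra.
Qed.

(** * Forests that are not represented *)

(** [level] rules out cycles of parents. It is 0 at roots, so [level x < d] bounds the depth,
    counted in vertices, by [d]. *)
Record rooted_forest (d : nat) := RootedForest {
  node :> finType;
  parent : node -> option node;
  level : node -> nat;
  levelE : forall x, level x = if parent x is Some y then (level y).+1 else 0;
  level_lt : forall x, level x < d }.

Lemma level_parent d (F : rooted_forest d) (x y : F) :
  parent x = Some y -> level x = (level y).+1.
Proof. by rewrite levelE => ->. Qed.

Section ForestGraph.
Variables (d : nat) (F : rooted_forest d).

Definition forest_edge : rel F :=
  fun x y => (parent x == Some y) || (parent y == Some x).

Lemma forest_edge_sym : symmetric forest_edge.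
Proof. by move=> x y; rewrite /forest_edge orbC. Qed.

Lemma forest_edge_irrefl : irreflexive forest_edge.
Proof.
move=> x; rewrite /forest_edge orbb; apply/negP => /eqP/level_parent; lia.
Qed.

Definition forest_graph : sgraph := SGraph forest_edge_sym forest_edge_irrefl.

Lemma forest_edge_level x y : forest_edge x y -> level y <= level x -> parent x = Some y.
Proof. by case/orP => /eqP // /level_parent ->; rewrite ltnn. Qed.

(* A vertex of maximal level on a cycle has its parent on both sides. *)
Lemma forest_graph_forest : forest forest_graph.
Proof.
move=> c; case: c => [|x0 c0] // cyc; set c := x0 :: c0 in cyc *.
have xc : x0 \in c by rewrite mem_head.
case: (arg_maxnP (fun x : F => level x) xc) => x xin xmax.
have [i c' Ec] := rot_to xin; move: cyc; rewrite -(rot_ucycle i) Ec -(size_rot i) Ec.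
have {}xmax y : y \in c' -> level y <= level x.
  move=> yc'; apply: (xmax y); apply: etrans (esym (mem_rot i c y)) _.
  by rewrite Ec inE yc' orbT.
case: c' xmax {Ec} => [|a [|b c']] xmax // /andP[].
rewrite /cycle rcons_path => /andP[/andP[xa _] yx] /and3P[_ aN _].
have Ea : parent x = Some a.
  by apply: forest_edge_level xa _; apply: xmax; exact: mem_head.
have Ey : parent x = Some (last b c').
  apply: forest_edge_level; first by rewrite forest_edge_sym.
  by apply: xmax; rewrite inE mem_last orbT.
by move: aN; move: Ey; rewrite Ea => -[->]; rewrite mem_last.
Qed.

Lemma root_exists (x : F) :
  exists r : F, parent r = None /\ connect (@edge forest_graph) x r.
Proof.
elim: {x}(level x) {-2}x (erefl (level x)) => [|n IH] x lx.
  exists x; split; last exact: connect0.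
  by case E: (parent x) => [y|] //; have := level_parent E; rewrite lx.
case E: (parent x) => [y|]; last by exists x; split=> //; exact: connect0.
have [r [rN yr]] : exists r : F, parent r = None /\ connect (@edge forest_graph) y r.
  by apply: IH; have := level_parent E; lia.
exists r; split=> //; apply: connect_trans yr; apply: connect1.
by rewrite /= /forest_edge E eqxx.
Qed.

(** A simple path from a root always descends: a step upwards would lead back to the previous
    vertex, the only parent. *)
Lemma up_path (r : F) p : parent r = None -> path forest_edge r p ->
  uniq (r :: p) -> level (last r p) = level r + size p /\
  forall q x, p = rcons q x -> parent x = Some (last r q).
Proof.
move=> rN; elim/last_ind: p => [|p x IH]; first by rewrite addn0; split=> // -[].
rewrite rcons_path -rcons_cons rcons_uniq => /andP[rp e] /andP[xN up].
have [IHl IHp] := IH rp up.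
have xP : parent x = Some (last r p).
  case/orP: e => /eqP // E; case/lastP: p IH rp xN up IHl IHp E => [|p y] _ _ /=.
    by rewrite rN.
  rewrite last_rcons => xN _ _ /(_ p y erefl) -> [xE].
  move: xN; rewrite -xE inE mem_rcons inE; case: p {xE} => [|z p] /=; first by rewrite eqxx.
  by rewrite (mem_last z p) !orbT.
split; first by rewrite last_rcons size_rcons (level_parent xP) IHl addnS.
by move=> q y /rcons_inj[<- <-].
Qed.

Lemma unique_root (r r' : F) : parent r = None -> parent r' = None ->
  connect (@edge forest_graph) r r' -> r = r'.
Proof.
move=> rN r'N /connectP[p0 /shortenP[p rp up _] E]; rewrite E.
case/lastP: p rp up E => [|p x] // rp up.
have [_ /(_ p x erefl)] := up_path rN rp up; rewrite last_rcons => xP xE.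
by move: r'N; rewrite xE xP.
Qed.

Lemma forest_depth_graph : forest_depth d forest_graph.
Proof.
split; first exact: forest_graph_forest.
exists [set x : F | parent x == None] => [x|r p].
  have [r [rN xr]] := root_exists x; exists r; split; first by rewrite inE rN.
  move=> r' [+ xr']; rewrite inE => /eqP r'N; apply: unique_root => //.
  apply: connect_trans xr'; rewrite sym_connect_sym //.
  exact: edge_sym.
rewrite inE => /eqP rN [rp up _].
have [E _] := up_path rN rp up.
by have := level_lt (last r p); rewrite E; apply: leq_ltn_trans; exact: leq_addl.
Qed.
End ForestGraph.

(** * Joining copies of a forest below new roots *)

Section Blowup.
Variables (N m d : nat) (F : rooted_forest d).

Definition blowup_node : finType := ('I_N * option ('I_m * F))%type.

(* [(i, None)] is the root of the [i]-th component, and its children are the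
   roots of the [m] copies of [F]. *)
Definition blowup_parent (v : blowup_node) : option blowup_node :=
  omap (fun jx => (v.1, omap (pair jx.1) (parent jx.2))) v.2.

Definition blowup_level (v : blowup_node) : nat :=
  if v.2 is Some jx then (level jx.2).+1 else 0.

Lemma blowup_levelE v :
  blowup_level v = if blowup_parent v is Some u then (blowup_level u).+1 else 0.
Proof.
case: v => [i [[j x]|]] //=; rewrite /blowup_level /= levelE.
by case: (parent x).
Qed.

Lemma blowup_level_lt v : blowup_level v < d.+1.
Proof. by case: v => [i [[j x]|]] //; rewrite ltnS level_lt. Qed.

Definition blowup : rooted_forest d.+1 := RootedForest blowup_levelE blowup_level_lt.

Lemma blowup_parent_copy (v u : blowup) : parent v = Some u -> v.1 = u.1.
Proof. by case: v u => [i [[j x]|]] [i' o] //= [->]. Qed.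

End Blowup.

Definition single_node : rooted_forest 1 :=
  @RootedForest 1 unit (fun _ => None) (fun _ => 0) (fun _ => erefl) (fun _ => erefl).

Lemma pigeonhole3 (T L : finType) (f : T -> L) : 2 * #|L| < #|T| ->
  exists i j l, [/\ i != j, j != l, l != i, f i = f j & f j = f l].
Proof.
move=> LT; case: (boolP [exists y, 2 < #|[pred x | f x == y]|]).
  move=> /existsP[y /card_gt2P[i [j [l [[]]]]]]; rewrite !inE.
  move=> /eqP fi /eqP fj /eqP fl [ij jl li].
  by exists i, j, l; rewrite fi fj fl.
rewrite negb_exists => /forallP H; move: LT; rewrite ltnNge -sum1_card.
rewrite (partition_big f xpredT) //= mulnC -sum_nat_const leq_sum // => y _.
by rewrite sum1_card; have := H y; rewrite -leqNgt.
Qed.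

(* If the copies [i], [j], [l] had equally labelled long edges [x_i y_i],
   [x_j y_j], [x_l y_l], then the non-adjacent pairs [x_a y_b], a != b, would be
   at distance at most [r], and the walk x_i y_j x_l y_i would bound the distance
   from [x_i] to [y_i] by [3 * r]. *)
Lemma exists_short_copy q (C K : finType) : exists r N,
  forall d (F : rooted_forest d) m (H : sgraph) (lam : H -> C) (h : blowup N m F -> H)
    (kap : blowup N m F -> K),
  (forall x y x' y', kap x = kap x' -> kap y = kap y' ->
      game_equiv lam q [:: (h x, h x'); (h y, h y')] ->
      edge (s := forest_graph _) x y = edge (s := forest_graph _) x' y') ->
  exists i : 'I_N, forall v u : blowup N m F, v.1 = i -> parent v = Some u ->
    dist_le r (h v) (h u).
Proof.
have [r [A [B Hloc]]] := game_equiv_far C q.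
(* Enough components for three of them to share all labels of their long edges. *)
pose N := (2 * #|{: (K * A) * (K * B)}|).+1.
exists (3 * r), N => d F m H lam h kap inv.
pose short i := [forall v : blowup N m F, forall u : blowup N m F, (v.1 == i) && (parent v == Some u) ==>
  dist_le (3 * r) (h v) (h u)].
case: (boolP [exists i, short i]) => [/existsP[i /forallP si]|].
  exists i => v u vi vu; have /forallP/(_ u) := si v.
  by rewrite vi vu !eqxx.
rewrite negb_exists => /forallP bad; exfalso.
have bad' i : exists vu : blowup N m F * blowup N m F,
    [/\ vu.1.1 = i, parent vu.1 = Some vu.2 & ~~ dist_le (3 * r) (h vu.1) (h vu.2)].
  have := bad i; rewrite negb_forall => /existsP[v]; rewrite negb_forall => /existsP[u].
  by rewrite negb_imply => /andP[/andP[/eqP vi /eqP vu] nd]; exists (v, u).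
have /fin_all_exists[e eP] := bad'; have [al [be ab]] := Hloc H lam.
have [|i [j [l [ij jl li Eij Ejl]]]] := @pigeonhole3 'I_N _
    (fun i => ((kap (e i).1, al (h (e i).1)), (kap (e i).2, be (h (e i).2)))).
  by rewrite card_ord.
(* If this pair were far apart, its labels would make it adjacent like the long edge of component
   [a], but its vertices lie in different components. *)
have cross a b : a != b -> kap (e a).1 = kap (e b).1 -> al (h (e a).1) = al (h (e b).1) ->
    kap (e a).2 = kap (e b).2 -> be (h (e a).2) = be (h (e b).2) ->
    dist_le r (h (e a).1) (h (e b).2).
  move=> nab k1 a1 k2 b2; case: (eP a) => ea1 ea2 ea3; case: (eP b) => eb1 eb2 _.
  case: (boolP (dist_le r (h (e a).1) (h (e b).2))) => // nd; exfalso.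
  have aa : ~~ dist_le r (h (e a).1) (h (e a).2).
    by apply: contra ea3; apply: dist_le_mono; lia.
  have := inv (e a).1 (e a).2 (e a).1 (e b).2 erefl k2 (ab _ _ _ _ aa nd erefl b2).
  rewrite /= /forest_edge ea2 eqxx /=.
  move/blowup_parent_copy: (ea2) => Ea; move/blowup_parent_copy: (eb2) => Eb.
  case/esym/orP => /eqP; first by move=> [E]; move/eqP: nab; apply; rewrite -ea1 -eb1 Ea Eb E.
  by move/blowup_parent_copy => E; move/eqP: nab; apply; rewrite -ea1 -eb1 Eb E.
have [Kij1 Aij Kij2 Bij] : [/\ kap (e i).1 = kap (e j).1, al (h (e i).1) = al (h (e j).1),
    kap (e i).2 = kap (e j).2 & be (h (e i).2) = be (h (e j).2)] by case: Eij.
have [Kjl1 Ajl Kjl2 Bjl] : [/\ kap (e j).1 = kap (e l).1, al (h (e j).1) = al (h (e l).1),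
    kap (e j).2 = kap (e l).2 & be (h (e j).2) = be (h (e l).2)] by case: Ejl.
have d1 : dist_le r (h (e i).1) (h (e j).2) by apply: cross.
have d2 : dist_le r (h (e l).1) (h (e j).2) by apply: cross => //; rewrite eq_sym.
have d3 : dist_le r (h (e l).1) (h (e i).2) by apply: cross => //; congruence.
case: (eP i) => _ _ /negP; apply.
rewrite (_ : 3 * r = r + r + r); last by lia.
by apply: dist_le_trans d3; apply: dist_le_trans d1 _; rewrite dist_le_sym.
Qed.

(** The induction is on [w] with [C] general, because passing to the cut part of [H] enlarges the
    labels. *)
Lemma not_represents w q (C K : finType) : exists F : rooted_forest w.+1,
  forall H, bags w H -> ~ represents q C K (forest_graph F) H.
Proof.
elim: w C => [|w IH] C.
  exists single_node => H [lo [hi [lohi _ bag]]] [_ [h _]].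
  suff : #|[set h tt]| <= 0 by rewrite cards1.
  by apply: (bag (lo (h tt))) => x; rewrite inE => /eqP ->; split=> //; exact: Rle_refl.
have [r [N shortP]] := exists_short_copy q C K.
(* A root path of the chosen component has at most [w.+1] edges, each of length at most [r] in [H];
   [s] is the bound of [bags_cut]. *)
pose D := r * w.+1; pose s := 2 * D.+1 + 2 * w.+1.
(* The second component of the new label will record the neighbours in [S]. A vertex of [H] is the
   image of at most [#|K|] vertices, so [S] meets at most [s * #|K|] copies of [F]. *)
have [F FP] := IH (C * {set 'I_s.+1})%type; pose m := (s * #|K|).+1.
exists (blowup N m F) => H bagH [lam [h [kap [hk_inj inv]]]].
have [i short] := shortP _ F m H lam h kap inv.
pose v0 : blowup N m F := (i, None).
have root_dist o : dist_le D (h v0) (h (i, o)).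
  case: o => [[j x]|]; last exact: dist_le_refl.
  apply: (@dist_le_mono _ (r * (level x).+1)); first by rewrite leq_mul2l level_lt orbT.
  elim: {x}(level x) {-2}x (erefl (level x)) => [|n IHn] x.
    rewrite levelE; case E: (parent x) => [y|] // _; rewrite muln1 dist_le_sym.
    by apply: short => //; rewrite /= /blowup_parent /= E.
  rewrite levelE; case E: (parent x) => [y|] // [/IHn yd].
  rewrite mulnS addnC; apply: dist_le_trans yd _; rewrite dist_le_sym.
  by apply: short => //; rewrite /= /blowup_parent /= E.
have [M [S [Ss bagM XM adjM]]] : exists (M : pred H) (S : {set H}),
    [/\ #|S| <= s, bags w (induced M),
        forall o, h (i, o) \notin S -> M (h (i, o))
      & forall u v, M u -> ~~ M v -> edge u v -> v \in S].
  have [||M [S [Ss bagM XM adjM]]] :=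
      @bags_cut w H D [set h (i, o) | o in [set: option ('I_m * F)]] (h v0) bagH.
  - by apply/imsetP; exists None; rewrite ?inE.
  - by move=> _ /imsetP[o _ ->].
  exists M, S; split=> // o oS; apply: XM oS.
  by apply/imsetP; exists o; rewrite ?inE.
have [idx idxK] := bounded_index Ss.
have [j jS] : exists j, forall x, h (i, Some (j, x)) \notin S.
  case: (boolP [exists j, [forall x, h (i, Some (j, x)) \notin S]]).
    by move=> /existsP[j /forallP jS]; exists j.
  rewrite negb_exists => /forallP hit; exfalso.
  have hit' j : exists x, h (i, Some (j, x)) \in S.
    by have := hit j; rewrite negb_forall => /existsP[x]; rewrite negbK; exists x.
  have /fin_all_exists[x xS] := hit'.
  pose g (j : 'I_m) := (h (i, Some (j, x j)), kap (i, Some (j, x j))).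
  have g_inj : injective g by move=> a b [/hk_inj H1 /H1[]].
  have : #|g @: [set: 'I_m]| <= #|setX S [set: K]|.
    apply: subset_leq_card; apply/subsetP => _ /imsetP[a _ ->].
    by rewrite in_setX xS inE.
  rewrite card_imset // cardsT card_ord cardsX cardsT /m.
  by have := leq_mul Ss (leqnn #|K|); lia.
have hM x : M (h (i, Some (j, x))) by exact: XM.
apply: (FP (induced M) bagM).
(* All neighbours outside [M] of a vertex in [M] lie in [S], so this label determines them. *)
pose lam' (u : induced M) := (lam (val u), [set idx t | t in [set t in S | edge (val u) t]]).
pose h' x : induced M := exist M (h (i, Some (j, x))) (hM x).
exists lam', h', (fun x => kap (i, Some (j, x))); split.
  by move=> x y /(congr1 val) /= /hk_inj H1 /H1[].
have edgeE x y : edge (s := forest_graph F) x y =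
    edge (s := forest_graph (blowup N m F)) (i, Some (j, x)) (i, Some (j, y)).
  rewrite /= /forest_edge /=.
  have E a b : (parent a == Some b) =
      (Some (i, omap (pair j) (parent a)) == Some (i, Some (j, b)) :> option (blowup N m F)).
    apply/eqP/eqP => [-> //|[]]; by case: (parent a) => //= c [->].
  by rewrite !E.
move=> x y x' y' kx ky gxy; rewrite !edgeE; apply: inv => //.
apply: game_equiv_induced gxy.
- by move=> u v [].
- move=> u v t [_ E] Mt.
  wlog suff sub : u v E / edge (val u) t -> edge (val v) t.
    by apply/idP/idP; apply: sub.
  move=> ut; have tS : t \in S by exact: adjM (valP u) Mt ut.
  have : idx t \in [set idx t | t in [set t in S | edge (val u) t]].
    by apply: imset_f; rewrite inE tS.
  by rewrite E => /imsetP[t']; rewrite inE => /andP[t'S vt'] /idxK ->.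
- move=> p; rewrite !inE => /orP[|] /eqP ->; left.
    by exists (h' x, h' x'); rewrite ?mem_head.
  by exists (h' y, h' y'); rewrite // !inE eqxx orbT.
Qed.

(** * Forests of bounded depth have bounded pathwidth *)

Section RootPaths.
Variable G : sgraph.
Hypothesis forestG : forest G.

Lemma forest_no_cycle x p : path (@edge G) x p -> uniq (x :: p) ->
  edge (last x p) x -> size p <= 1.
Proof.
move=> xp up e; have : ucycle (@edge G) (x :: p) by rewrite /ucycle /cycle rcons_path xp e.
by move/forestG.
Qed.

(** If the paths part at [x] towards [a] and [b], following one and returning along the other joins
    [a] to [b] without [x]; shortened and closed through [x], this is a cycle. *)
Lemma forest_path_unique x p q : path (@edge G) x p -> uniq (x :: p) ->
  path (@edge G) x q -> uniq (x :: q) -> last x p = last x q -> p = q.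
Proof.
have not_back (y b : G) q' : uniq (y :: b :: q') -> y = last b q' -> False.
  by move=> /andP[yN _] yE; rewrite yE mem_last in yN.
elim: p x q => [|a p IH] x [|b q] //=.
- by move=> _ _ _ u /(not_back _ _ _ u).
- by move=> _ u _ _ /esym/(not_back _ _ _ u).
move=> /andP[xa ap] /andP[xp up] /andP[xb bq] /andP[xq uq] E.
have [ab|ab] := eqVneq a b.
  by subst b; congr cons; apply: (IH a).
have w : path (@edge G) a (p ++ rev (belast b q)).
  by rewrite cat_path ap E rev_path; under eq_path do rewrite edge_sym.
have wb : last a (p ++ rev (belast b q)) = b.
  rewrite last_cat; case: (q) E => [|c q'] /= -> //.
  by rewrite rev_cons last_rcons.
have xw : x \notin a :: p ++ rev (belast b q).
  rewrite inE mem_cat mem_rev !negb_or; move: xp; rewrite inE negb_or => /andP[-> ->] /=.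
  by apply: contra xq => /mem_belast.
move: wb; case/shortenP: w => s as_ us ss sb.
suff : size (a :: s) <= 1 by case: (s) sb ab => //= ->; rewrite eqxx.
apply: (@forest_no_cycle x); first by rewrite /= xa.
  rewrite cons_uniq us andbT; apply: contra xw; rewrite !inE => /orP[->//|/ss ->].
  by rewrite orbT.
by rewrite /= sb edge_sym.
Qed.

(** This carries the depth bound from root-to-leaf paths over to all simple paths from a root. *)
Lemma extend_to_leaf r p : path (@edge G) r p -> uniq (r :: p) ->
  exists2 p', path_to_leaf r p' & size p <= size p'.
Proof.
move En : (#|G| - size p) => n; elim: n p En => [|n IH] p En rp up.
  have := max_card (mem (r :: p)); rewrite (card_uniqP up) /= => pG.
  by move/eqP: En; rewrite subn_eq0 leqNgt pG.
case: (boolP [forall y, edge (last r p) y ==> (y \in r :: p)]) => [/forallP H|].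
  by exists p => //; split=> // y; apply/implyP.
rewrite negb_forall => /existsP[y]; rewrite negb_imply => /andP[ey yN].
have [|||p' pl sp] := IH (rcons p y).
- by rewrite size_rcons; lia.
- by rewrite rcons_path rp.
- by rewrite -rcons_cons rcons_uniq yN.
by exists p' => //; rewrite size_rcons in sp; apply: ltnW.
Qed.

Lemma root_paths d (R : {set G}) : rooting R ->
  (forall r p, r \in R -> path_to_leaf r p -> size (r :: p) <= d) ->
  exists (rt : G -> G) (pt : G -> seq G), forall x,
    [/\ last (rt x) (pt x) = x, size (rt x :: pt x) <= d
      & forall y, edge x y -> rt x = rt y /\
          (pt y = rcons (pt x) y \/ pt x = rcons (pt y) x)].
Proof.
move=> rootR depth.
have ex x : exists rp : G * seq G, [/\ rp.1 \in R, path (@edge G) rp.1 rp.2,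
    uniq (rp.1 :: rp.2) & last rp.1 rp.2 = x].
  have [r [[rR]]] := rootR x; rewrite sym_connect_sym; last exact: edge_sym.
  by move=> /connectP[p0 /shortenP[p rp up _] ->] _; exists (r, p).
have /fin_all_exists[rp rpP] := ex.
have rt_edge x y : edge x y -> (rp x).1 = (rp y).1.
  move=> xy; have [r [_ runiq]] := rootR x.
  have [xR px ux lx] := rpP x; have [yR py uy ly] := rpP y.
  have cs := sym_connect_sym (@edge_sym G).
  have <- : r = (rp x).1.
    by apply: runiq; split=> //; rewrite cs; apply/connectP; exists (rp x).2.
  apply: runiq; split=> //; apply: connect_trans (connect1 xy) _.
  by rewrite cs; apply/connectP; exists (rp y).2.
exists (fun x => (rp x).1), (fun x => (rp x).2) => x.
have [xR px ux lx] := rpP x; split=> //.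
  have [p' pl sp] := extend_to_leaf px ux.
  by apply: leq_trans (depth _ _ xR pl).
move=> y xy; have E := rt_edge x y xy; split=> //.
have [yR py uy ly] := rpP y; rewrite -E in py uy ly.
have [yx|yx] := boolP (y \in (rp x).1 :: (rp x).2); last first.
  left; apply: (forest_path_unique py uy).
  - by rewrite rcons_path px lx.
  - by rewrite -rcons_cons rcons_uniq yx.
  - by rewrite last_rcons.
(* The rest [p2] of the path leads from [y] to its neighbour [x], so it is a single edge, as
   otherwise it would close to a cycle. *)
right; move: px ux lx; case/splitPl: yx => p1 p2 l1; rewrite cat_path l1 last_cat l1.
move=> /andP[px1 px2] u lx; have u2 : uniq (y :: p2).
  move: u; rewrite -cat_cons lastI cat_rcons l1 cat_uniq => /and3P[_ _ //].
have := forest_no_cycle px2 u2; rewrite lx => /(_ xy).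
have pE : (rp y).2 = p1.
  apply: (forest_path_unique py uy px1); last by rewrite l1.
  by move: u; rewrite -cat_cons cat_uniq => /andP[].
case: p2 px2 u2 lx {u} => [|z [|]] //= _ _ lx _.
  by move: xy; rewrite lx edge_irrefl.
by rewrite lx pE cats1.
Qed.
End RootPaths.

(** * An interval supergraph built from root paths *)

Section TreeIntervals.
Variables (G : sgraph) (d : nat) (rt : G -> G) (pt : G -> seq G).
Hypothesis rootP : forall x,
  [/\ last (rt x) (pt x) = x, size (rt x :: pt x) <= d
    & forall y, edge x y -> rt x = rt y /\
        (pt y = rcons (pt x) y \/ pt x = rcons (pt y) x)].

(** The root path of [x] gives the base-[#|G|] digits of [code x]. The integers from [left x] to
    [right x] are the [d]-digit numbers starting with these digits, so children are nested in their
    parents and different vertices of equal depth are disjoint. *)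
Let digits : seq G -> nat := foldl (fun a v => a * #|G| + enum_rank v) 0.
Let code x := digits (rt x :: pt x).
Let depth x := size (rt x :: pt x).
Let width x := #|G| ^ (d - depth x).
Let left x := code x * width x.
Let right x := code x * width x + (width x).-1.

Let child x y := [/\ rt x = rt y & pt y = rcons (pt x) y].

Lemma code_rank x : exists a, code x = a * #|G| + enum_rank x.
Proof.
have [lx _ _] := rootP x.
exists (digits (belast (rt x) (pt x))).
by rewrite /code /digits lastI foldl_rcons lx.
Qed.

(** The last digit of [code x] is the rank of [x] itself. *)
Lemma code_inj : injective code.
Proof.
move=> x y; have [a ->] := code_rank x; have [b ->] := code_rank y.
move/(congr1 (modn^~ #|G|)); rewrite !modnMDl !modn_small ?ltn_ord //.
by move/ord_inj/enum_rank_inj.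
Qed.

Lemma width_gt0 x : 0 < width x.
Proof. by rewrite /width expn_gt0 (@leq_trans (enum_rank x).+1) // ltn_ord. Qed.

Lemma left_le_right x : left x <= right x.
Proof. exact: leq_addr. Qed.

Lemma child_nested x y : child x y -> left x <= left y /\ right y <= right x.
Proof.
move=> [rE pE].
have cE : code y = code x * #|G| + enum_rank y.
  by rewrite /code /digits -rE pE -rcons_cons foldl_rcons.
have wE : width x = #|G| * width y.
  have [_ + _] := rootP y; rewrite /width /depth -rE pE -rcons_cons size_rcons => sz.
  by rewrite -expnS; congr expn; lia.
have := width_gt0 y; have : enum_rank y < #|G| by exact: ltn_ord.
rewrite /left /right cE wE => kN w0; split; first by rewrite mulnA leq_mul2r leq_addr orbT.
suff H c k N w : k < N -> 0 < w -> (c * N + k) * w + w.-1 <= c * (N * w) + (N * w).-1.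
  exact: H.
by move=> {}kN {}w0; have := leq_mul kN (leqnn w); lia.
Qed.

Definition tree_meet x y := (left x <= right y) && (left y <= right x).

Lemma tree_meet_edge x y : edge x y -> tree_meet x y.
Proof.
have [_ _ H] := rootP x; move=> /H[rE [pE|pE]].
  have [|? ?] := @child_nested x y; first by [].
  by have := left_le_right y; rewrite /tree_meet; lia.
have [|? ?] := @child_nested y x; first by [].
by have := left_le_right x; rewrite /tree_meet; lia.
Qed.

Lemma tree_meet_depth x y : tree_meet x y -> depth x = depth y -> x = y.
Proof.
move=> /andP[xy yx] E; apply: code_inj.
have wE : width x = width y by rewrite /width E.
have w0 := width_gt0 y; move: xy yx; rewrite /left /right wE => xy yx.
have lt a b : a * width y <= b * width y + (width y).-1 -> a <= b.
  by move=> ab; rewrite -ltnS -(ltn_pmul2r w0); lia.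
by apply/eqP; rewrite eqn_leq (lt _ _ xy) (lt _ _ yx).
Qed.

Definition tree_interval_edge : rel G := fun x y => (x != y) && tree_meet x y.

Lemma tree_interval_edge_sym : symmetric tree_interval_edge.
Proof.
by move=> x y; rewrite /tree_interval_edge eq_sym /tree_meet [in RHS](andbC (left y <= _)).
Qed.

Lemma tree_interval_edge_irrefl : irreflexive tree_interval_edge.
Proof. by move=> x; rewrite /tree_interval_edge eqxx. Qed.

Definition tree_interval_graph : sgraph :=
  SGraph tree_interval_edge_sym tree_interval_edge_irrefl.

Lemma tree_interval_graph_interval : interval_graph tree_interval_graph.
Proof.
exists (fun x => INR (left x)), (fun x => INR (right x)); split=> [x|x y xy].
  by apply: le_INR; apply/leP; exact: left_le_right.
rewrite /= /tree_interval_edge xy andTb /tree_meet; split=> [/andP[lr rl]|[t [t1 t2 t3 t4]]].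
  exists (INR (maxn (left x) (left y))).
  by split; apply: le_INR; apply/leP; have := left_le_right x; have := left_le_right y; lia.
by apply/andP; split; apply/leP; apply: INR_le; lra.
Qed.

(** The vertices of a clique have different depths, and only [d] depths occur. *)
Lemma tree_interval_graph_clique : clique_number tree_interval_graph <= d.
Proof.
apply/bigmax_leqP => A /forall_inP Acl.
have dep x : (depth x).-1 < d by have [_ + _] := rootP x.
have inj : {in A &, injective (fun x => Ordinal (dep x))}.
  move=> x y xA yA [E]; have [//|xy] := eqVneq x y.
  have /forall_inP/(_ y yA) := Acl x xA; rewrite xy => /andP[_ m].
  by apply: tree_meet_depth m _; exact: (congr1 S E).
by rewrite -(card_in_imset inj) (leq_trans (max_card _)) ?card_ord.
Qed.

Lemma subgraph_tree_interval_graph : subgraph G tree_interval_graph.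
Proof.
exists id; split=> // x y xy; apply/andP; split; last exact: tree_meet_edge.
by apply: contraTneq xy => ->; rewrite edge_irrefl.
Qed.
End TreeIntervals.

(** [is_pathwidth] asks for an attained minimum, so one descends from [H] to an interval supergraph
    of least clique number, by excluded middle at each stage. *)
Lemma pathwidth_leI n G H : interval_graph H -> subgraph G H ->
  clique_number H <= n.+1 -> pathwidth_le n G.
Proof.
move En : (clique_number H) => m iH sH mn.
elim/ltn_ind: m H En iH sH mn => m IH H En iH sH mn.
case: (classic (exists H', [/\ interval_graph H', subgraph G H' & clique_number H' < m])).
  by move=> [H' [iH' sH' lt]]; apply: (IH _ lt H') => //; apply: leq_trans mn; exact: ltnW.
move=> Hmin; exists (Posz m - Posz 1)%R; last by lia.
split; first by exists H; rewrite En.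
move=> H' iH' sH'; suff : m <= clique_number H' by lia.
by rewrite leqNgt; apply/negP => lt; apply: Hmin; exists H'.
Qed.

Lemma forest_depth_pathwidth n G : forest_depth n.+1 G -> pathwidth_le n G.
Proof.
move=> [forestG [R rootR depth]].
have [rt [pt rootP]] := root_paths forestG rootR depth.
apply: (@pathwidth_leI n G (tree_interval_graph n.+1 rt pt)).
- exact: tree_interval_graph_interval.
- exact: subgraph_tree_interval_graph.
- exact: tree_interval_graph_clique.
Qed.

(** * The identity transduction and the conclusion *)

Section Identity.

Let true_formula : formula unit 1 := FNot (FFalse unit 1).
Let edge_formula : formula unit 2 := FEdge unit ord0 (lift ord0 ord0).

Lemma edge_formulaE G (c : expansion unit G) (x y : G) :
  sat c edge_formula [tuple x; y] = edge x y.
Proof. by []. Qed.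

Lemma edge_formula_sym G (c : expansion unit G) (x y : G) :
  sat c edge_formula [tuple x; y] = sat c edge_formula [tuple y; x].
Proof. by rewrite !edge_formulaE edge_sym. Qed.

Lemma edge_formula_irrefl G (c : expansion unit G) (x : G) :
  sat c edge_formula [tuple x; x] = false.
Proof. by rewrite edge_formulaE edge_irrefl. Qed.

Definition identity_transduction : transduction :=
  @Transduction 1 isT unit
    (@Interpretation unit true_formula edge_formula edge_formula_sym edge_formula_irrefl).

Lemma fo_le_sub (C D : graph_class) : (forall G, C G -> D G) -> fo_le C D.
Proof.
move=> CD; exists identity_transduction => G /CD DG; exists G => //.
exists (fun _ _ => true).
pose f (x : G) : interp_vertex (interp identity_transduction)
    (fun _ _ => true : bool) := Sub ((x, ord0) : copy 1 G) isT.
exists f; split.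
  exists (fun v => (val v).1) => [x //|[[x i] p]].
  by apply: val_inj; rewrite /= (ord1 i).
by move=> x y; rewrite /= /interp_edge edge_formulaE /= /copy_edge /= andbF orbF.
Qed.
End Identity.

Theorem theorem20p14 :
  forall n : nat, 1 <= n ->
    [/\ fo_le (forest_depth (n + 2)) (pathwidth_le (n + 1)),
        ~ fo_le (forest_depth (n + 2)) (pathwidth_le n)
      & ~ fo_le (pathwidth_le (n + 1)) (pathwidth_le n)].
Proof.
move=> n _; rewrite addn2 addn1.
have sub G : forest_depth n.+2 G -> pathwidth_le n.+1 G := @forest_depth_pathwidth n.+1 G.
have main : ~ fo_le (forest_depth n.+2) (pathwidth_le n).
  move=> [T le]; have [q [C [K rep]]] := transduce_represents T.
  (* Pathwidth [n] means bags of size [n.+1], against which the forest has depth [n.+2]. *)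
  have [F FN] := not_represents n.+1 q C K.
  have [H /pathwidth_le_bags bagH] := rep _ _ (le _ (forest_depth_graph F)).
  exact: FN.
split=> //; first exact: fo_le_sub.
by move=> [T le]; apply: main; exists T => G /sub /le.
Qed.
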